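(* Let $R$ be a commutative noetherian ring, let $\mathcal{S}_{f.g.}$ be the subcategory of $R\text{-}\mathrm{Mod}$ consisting of finitely generated $R$-modules, and let $\mathcal{S}$ be a Serre subcategory of $R\text{-}\mathrm{Mod}$. Then the subcategory $(\mathcal{S}_{f.g.}, \mathcal{S})$ is a Serre subcategory of $R\text{-}\mathrm{Mod}$.
   Context: $R\text{-}\mathrm{Mod}$ denotes the category of all (unitary) $R$-modules. All full subcategories are assumed closed under isomorphisms. A Serre subcategory of an abelian category is a full subcategory closed under subobjects, quotient objects and extensions (in particular it contains the zero object). For Serre subcategories $\mathcal{S}_1, \mathcal{S}_2$ of $R\text{-}\mathrm{Mod}$, $(\mathcal{S}_1, \mathcal{S}_2)$ denotes the full subcategory of $R\text{-}\mathrm{Mod}$ consisting of all $R$-modules $M$ for which there exists a short exact sequence $0 \to S_1 \to M \to S_2 \to 0$ of $R$-modules with $S_1 \in \mathcal{S}_1$ and $S_2 \in \mathcal{S}_2$. *)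

(* Defs.v *)
From HB Require Import structures.
From mathcomp Require Import all_boot all_order all_algebra.

Set Implicit Arguments.
Unset Strict Implicit.
Unset Printing Implicit Defensive.

Import GRing.Theory.
Local Open Scope ring_scope.

(* Subsets are Prop-valued, so that no decidability of membership is assumed. *)
Definition is_ideal (R : comPzRingType) (I : R -> Prop) : Prop :=
  [/\ I 0,
      (forall x y, I x -> I y -> I (x + y))
    & (forall a x, I x -> I (a * x))].

Definition noetherian (R : comPzRingType) : Prop :=
  forall I : R -> Prop, is_ideal I ->
    exists (n : nat) (e : 'I_n -> R),
      forall x, I x <-> exists a : 'I_n -> R, x = \sum_(i < n) a i * e i.

Definition finitely_generated (R : comPzRingType) (M : lmodType R) : Prop :=
  exists (n : nat) (e : 'I_n -> M),
    forall m : M, exists a : 'I_n -> R, m = \sum_(i < n) a i *: e i.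

Definition surj (A B : Type) (f : A -> B) : Prop :=
  forall b, exists a, f a = b.

Definition short_exact (R : comPzRingType) (L M N : lmodType R)
    (f : {linear L -> M}) (g : {linear M -> N}) : Prop :=
  [/\ injective f,
      surj g
    & forall m : M, g m = 0 <-> exists l : L, f l = m].

(* A full subcategory of the category of R-modules is given by its class of
   objects, a predicate on [lmodType R]. *)
Record serre (R : comPzRingType) (S : lmodType R -> Prop) : Prop := Serre {
  serre_iso : forall (M N : lmodType R) (f : {linear M -> N}),
    bijective f -> S M -> S N;
  serre_zero : forall M : lmodType R, (forall m : M, m = 0) -> S M;
  serre_sub : forall (L M : lmodType R) (f : {linear L -> M}),
    injective f -> S M -> S L;
  serre_quo : forall (M N : lmodType R) (g : {linear M -> N}),
    surj g -> S M -> S N;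
  serre_ext : forall (L M N : lmodType R)
      (f : {linear L -> M}) (g : {linear M -> N}),
    short_exact f g -> S L -> S N -> S M
}.

Definition ext_subcat (R : comPzRingType) (S1 S2 : lmodType R -> Prop)
    (M : lmodType R) : Prop :=
  exists (L N : lmodType R) (f : {linear L -> M}) (g : {linear M -> N}),
    [/\ S1 L, S2 N & short_exact f g].

(* Main.v *)
Require Import Defs.
From HB Require Import structures.
From mathcomp Require Import all_boot all_order all_algebra.
From mathcomp Require Import boolp.

(** Say that a module [M] is in [S] modulo finitely generated modules
    ([in_mod_fg S M] below) when some finite list [s] of its elements has the
    property that every quotient of [M] killing [s] is in [S]; for a Serre class [S] this only says that the largest
    such quotient, [M] modulo the span of [s], is in [S].  This is the same as
    being an extension of an object of [S] by a finitely generated module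
    ([ext_subcatE]), and the closure properties become easy to see.

    - Quotients: the image of the list works, since a quotient of a quotient of
      [M] is a quotient of [M].
    - Extensions: if [M] is an extension of [N] by [L], take the list of [L]
      followed by lifts of the list of [N].  A quotient [Q] of [M] killing both
      is itself an extension of a quotient of [N] by the image of [L] in [Q],
      and these two are in [S].
    - Submodules: let [L] be a submodule of [M], and let [K] be its
      intersection with the span of the list [s] of [M].  As the ring is
      noetherian, [K] is finitely generated ([noetherian_span]); its generators
      are the list wanted for [L], because [L / K] embeds in [M] modulo the span
      of [s].

    All objects that the argument has to construct are quotients by
    submodules ([quotient_exists]): images, too, are obtained as quotients by
    kernels ([image_exists]). *)

Set Implicit Arguments.
Unset Strict Implicit.
Unset Printing Implicit Defensive.

Import GRing.Theory.
Local Open Scope ring_scope.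
Local Open Scope quotient_scope.

(** * Submodules and spans *)

Section Submodules.
Variable R : comPzRingType.
Implicit Types L M N : lmodType R.

Record submodule M (P : M -> Prop) : Prop := Submodule {
  submod0 : P 0;
  submodD : forall x y, P x -> P y -> P (x + y);
  submodZ : forall a x, P x -> P (a *: x)
}.

Lemma submodN M (P : M -> Prop) : submodule P -> forall x, P x -> P (- x).
Proof. by move=> hP x hx; rewrite -scaleN1r; apply: (submodZ hP). Qed.

Lemma submodB M (P : M -> Prop) :
  submodule P -> forall x y, P x -> P y -> P (x - y).
Proof. by move=> hP x y hx hy; apply: (submodD hP) => //; apply: submodN. Qed.

Lemma submod_sum M (P : M -> Prop) n (F : 'I_n -> M) :
  submodule P -> (forall i, P (F i)) -> P (\sum_(i < n) F i).
Proof.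
by move=> hP hF; apply: big_ind => //; [apply: submod0 | apply: submodD].
Qed.

Lemma submodule_kernel M N (f : {linear M -> N}) :
  submodule (fun x => f x = 0).
Proof.
split=> [|x y hx hy|a x hx]; first exact: linear0.
  by rewrite linearD hx hy addr0.
by rewrite linearZ /= hx scaler0.
Qed.

Lemma submodule_preimage M N (f : {linear M -> N}) (P : N -> Prop) :
  submodule P -> submodule (fun x => P (f x)).
Proof.
move=> hP; split=> [|x y hx hy|a x hx]; first by rewrite linear0; exact: submod0.
  by rewrite linearD; apply: submodD.
by rewrite linearZ; apply: submodZ.
Qed.

Lemma submodule_image M N (f : {linear M -> N}) :
  submodule (fun y => exists x, f x = y).
Proof.
split=> [|_ _ [x <-] [y <-]|a _ [x <-]]; first by exists 0; rewrite linear0.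
  by exists (x + y); rewrite linearD.
by exists (a *: x); rewrite linearZ.
Qed.

Lemma submoduleI M (P P' : M -> Prop) :
  submodule P -> submodule P' -> submodule (fun x => P x /\ P' x).
Proof.
move=> hP hP'; split=> [|x y [] hx hx' [] hy hy'|a x [] hx hx'].
- by split; apply: submod0.
- by split; apply: submodD.
- by split; apply: submodZ.
Qed.

(** Defined by minimality rather than by linear combinations, so that an
    inclusion of a span in a submodule only has to be checked on generators. *)
Definition span M (s : seq M) (x : M) : Prop :=
  forall P : M -> Prop, submodule P -> (forall y, y \in s -> P y) -> P x.

Lemma span_submodule M (s : seq M) : submodule (span s).
Proof.
split=> [|x y hx hy|a x hx] P hP hs; first exact: submod0.
  by apply: submodD => //; [apply: hx | apply: hy].
by apply: submodZ => //; apply: hx.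
Qed.

Lemma mem_span M (s : seq M) x : x \in s -> span s x.
Proof. by move=> xs P _; apply. Qed.

Lemma sub_span M (s t : seq M) :
  {subset s <= t} -> forall x, span s x -> span t x.
Proof.
by move=> st x hx; apply: hx => [|y /st]; [apply: span_submodule|apply: mem_span].
Qed.

Lemma span_nil M (x : M) : span [::] x -> x = 0.
Proof.
move/(_ (fun y => y = 0)); apply=> //; split=> // [_ _ -> ->|a _ ->].
  exact: addr0.
exact: scaler0.
Qed.

Lemma span_cons M (s : seq M) y x :
  span (y :: s) x -> exists a, span s (x - a *: y).
Proof.
have hs := span_submodule s.
move/(_ (fun x => exists a, span s (x - a *: y))); apply=> [|z]; last first.
  rewrite inE => /predU1P[->|zs].
    by exists 1; rewrite scale1r subrr; exact: (submod0 hs).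
  by exists 0; rewrite scale0r subr0; apply: mem_span.
split=> [|u v [a ha] [b hb]|c u [a ha]].
- by exists 0; rewrite scale0r subr0; exact: (submod0 hs).
- by exists (a + b); rewrite scalerDl opprD addrACA; apply: (submodD hs).
- by exists (c * a); rewrite -scalerA -scalerBr; apply: (submodZ hs).
Qed.

(** A noetherian ring has noetherian finitely generated modules: a submodule
    [K] whose image lies in a finitely generated module has a finitely generated
    image, and the generators lift to [K].  The proof goes by induction on [s].
    For [s = y :: s'], the coefficients of [y] in the elements of [f K] form
    an ideal; lifts to [K] of generators of it, together with generators for the
    part of [K] mapped into the span of [s'], are enough. *)
Lemma noetherian_span L M (f : {linear L -> M}) (s : seq M) (K : L -> Prop) :
    noetherian R -> submodule K -> (forall x, K x -> span s (f x)) ->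
  exists2 t : seq L, (forall y, y \in t -> K y) &
    forall x, K x -> exists2 y, span t y & f x = f y.
Proof.
move=> hR; elim: s K => [|y s IH] K hK Ks.
  exists [::] => // x /Ks/span_nil ->.
  by exists 0; [exact: (submod0 (span_submodule _)) | rewrite linear0].
have hs := span_submodule s.
pose I a := exists2 x, K x & span s (f x - a *: y).
have /hR[n [e eI]] : is_ideal I.
  split=> [|a b [x Kx hx] [z Kz hz]|c a [x Kx hx]].
  - exists 0; first exact: (submod0 hK).
    by rewrite linear0 scale0r subrr; exact: (submod0 hs).
  - exists (x + z); first exact: (submodD hK).
    by rewrite linearD scalerDl opprD addrACA; apply: (submodD hs).
  - exists (c *: x); first exact: (submodZ hK).
    by rewrite linearZ /= -scalerA -scalerBr; apply: (submodZ hs).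
have /choice[z hz] : forall i, exists x, K x /\ span s (f x - e i *: y).
  move=> i; suff [x Kx hx] : I (e i) by exists x.
  apply/eI; exists (fun j => (j == i)%:R).
  rewrite (bigD1 i) //= eqxx mul1r big1 ?addr0 // => j /negbTE ->.
  exact: mul0r.
have [t tK ht] := IH _ (submoduleI hK (submodule_preimage f hs))
  (fun x => @proj2 _ _).
exists (codom z ++ t) => [x|x Kx].
  by rewrite mem_cat => /orP[/codomP[i ->]|/tK[]//]; case: (hz i).
have [a ha] := span_cons (Ks _ Kx).
have [|b ab] := (eI a).1; first by exists x.
pose w := \sum_(i < n) b i *: z i.
have Kw : K w.
  by apply: (submod_sum hK) => i; apply: (submodZ hK); case: (hz i).
have fw : span s (f w - a *: y).
  rewrite ab scaler_suml linear_sum -sumrB; apply: (submod_sum hs) => i.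
  by rewrite linearZ /= -scalerA -scalerBr; apply: (submodZ hs); case: (hz i).
have [|v tv fv] := ht (x - w).
  split; first exact: (submodB hK).
  have -> : f (x - w) = (f x - a *: y) - (f w - a *: y).
    by rewrite linearB opprB addrA subrK.
  exact: (submodB hs).
exists (w + v); last by rewrite linearD -fv linearB addrC subrK.
apply: (submodD (span_submodule _)).
  apply: (submod_sum (span_submodule _)) => i.
  apply: (submodZ (span_submodule _)); apply: mem_span.
  by rewrite mem_cat codom_f.
by apply: (sub_span _ tv) => u ut; rewrite mem_cat ut orbT.
Qed.

End Submodules.

(** * Quotient modules *)

Section ModuleQuotient.
Variables (R : comPzRingType) (M : lmodType R).
Variables (P : M -> Prop) (hP : submodule P).

(** Additive quotients are formed by boolean predicates, hence [asbool]. *)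
Definition submod_pred : {pred M} := fun x => `[< P x >].

Lemma submod_pred_closed : zmod_closed submod_pred.
Proof.
split=> [|u v /asboolP hu /asboolP hv]; apply/asboolP; first exact: (submod0 hP).
exact: (submodB hP).
Qed.

Definition submod_zmod : zmodClosed M :=
  HB.pack submod_pred (GRing.isZmodClosed.Build M submod_pred submod_pred_closed).

Definition quotmod : Type := Quotient.quot submod_zmod.
Local Notation Q := quotmod.

HB.instance Definition _ := ZmodQuotient.on Q.

Definition quot_scale (a : R) : Q -> Q := lift_op1 Q ( *:%R a).

Lemma pi_quotD : {morph \pi_Q : x y / x + y >-> x + y}.
Proof. by move=> x y; rewrite raddfD. Qed.

Lemma pi_quot_eq0 x : \pi_Q x = 0 <-> P x.
Proof.
rewrite -[0](raddf0 \pi_Q) /=.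
have -> : P x = (x - 0 \in submod_zmod) by rewrite subr0 -[P x]asboolE.
by rewrite Quotient.idealrBE; split=> /eqP.
Qed.

Lemma pi_quot_scale a : {morph \pi_Q : x / a *: x >-> quot_scale a x}.
Proof.
move=> x; unlock quot_scale; apply/eqP; rewrite piE Quotient.equivE.
rewrite -scalerBr; apply/asboolP/(submodZ hP)/asboolP.
by rewrite -[asbool _]/(_ \in submod_zmod) Quotient.idealrBE reprK.
Qed.

Lemma quot_scaleA a b v :
  quot_scale a (quot_scale b v) = quot_scale (a * b) v.
Proof. by rewrite -[v]reprK -!pi_quot_scale scalerA. Qed.

Lemma quot_scale1 : left_id 1 quot_scale.
Proof. by move=> v; rewrite -[v]reprK -pi_quot_scale scale1r. Qed.

Lemma quot_scaleDr : right_distributive quot_scale +%R.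
Proof.
move=> a u v; rewrite -[u]reprK -[v]reprK -!pi_quot_scale.
by rewrite -!pi_quotD -pi_quot_scale scalerDr.
Qed.

Lemma quot_scaleDl v : {morph quot_scale^~ v : a b / a + b}.
Proof.
move=> a b /=; rewrite -[v]reprK -!pi_quot_scale.
by rewrite scalerDl pi_quotD.
Qed.

HB.instance Definition _ := GRing.Zmodule_isLmodule.Build R Q
  quot_scaleA quot_scale1 quot_scaleDr quot_scaleDl.

Lemma pi_quot_linear : linear (\pi_Q : M -> Q).
Proof. by move=> a u v; rewrite pi_quotD pi_quot_scale. Qed.

HB.instance Definition _ :=
  GRing.isLinear.Build R M Q _ (\pi_Q : M -> Q) pi_quot_linear.

End ModuleQuotient.

(** * Quotients and images in the category of modules *)

Section QuotientsAndImages.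
Variable R : comPzRingType.
Implicit Types A B I L M N Q : lmodType R.

Lemma quotient_exists M (P : M -> Prop) : submodule P ->
  exists Q (q : {linear M -> Q}), surj q /\ forall x, q x = 0 <-> P x.
Proof.
move=> hP; exists (quotmod hP), (\pi_(quotmod hP)).
by split=> [v|x]; [exists (repr v); exact: reprK | exact: pi_quot_eq0].
Qed.

(** Not only [h] but also its linearity descends, although the section [r] of [q]
    is in general not linear: [h \o r] is independent of the choice of [r]. *)
Lemma factor_through_surj M Q N (q : {linear M -> Q}) (h : {linear M -> N}) :
    surj q -> (forall x, q x = 0 -> h x = 0) ->
  exists h' : {linear Q -> N}, forall x, h' (q x) = h x.
Proof.
move=> /choice[r rK] hqh.
have hr x : h (r (q x)) = h x.
  by apply/subr0_eq; rewrite -linearB hqh // linearB rK subrr.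
have lin : linear (h \o r).
  move=> a u v /=; rewrite -{1}[u]rK -{1}[v]rK.
  by rewrite -linearP hr linearP.
pose h' : {linear Q -> N} :=
  HB.pack (h \o r) (GRing.isLinear.Build R Q N _ (h \o r) lin).
by exists h'.
Qed.

Lemma image_exists A B (h : {linear A -> B}) :
  exists I (p : {linear A -> I}) (i : {linear I -> B}),
    [/\ surj p, injective i & forall x, i (p x) = h x].
Proof.
have [I [p [ps pK]]] := quotient_exists (submodule_kernel h).
have [i hi] := factor_through_surj ps (fun x => (pK x).1).
exists I, p, i; split=> // u v.
have [[x <-] [y <-]] := (ps u, ps v); rewrite !hi => hxy.
by apply/subr0_eq; rewrite -linearB; apply/pK; rewrite linearB hxy subrr.
Qed.

(** * Serre classes modulo finitely generated modules *)

(** Quantifying over all quotients that kill [s] avoids naming the quotient of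
    [M] by the span of [s], and so makes stability under quotients immediate. *)
Definition in_mod_fg (S : lmodType R -> Prop) M : Prop :=
  exists s : seq M, forall Q (q : {linear M -> Q}),
    surj q -> (forall x, x \in s -> q x = 0) -> S Q.

Lemma kill_span M Q (q : {linear M -> Q}) (s : seq M) :
  (forall x, x \in s -> q x = 0) -> forall x, span s x -> q x = 0.
Proof. by move=> qs x /(_ _ (submodule_kernel q)); apply. Qed.

Lemma surj_comp (A B C : Type) (f : A -> B) (g : B -> C) :
  surj f -> surj g -> surj (g \o f).
Proof. by move=> hf hg c; have [b <-] := hg c; have [a <-] := hf b; exists a. Qed.

Variables (S : lmodType R -> Prop) (hS : serre S).

(** [Q] is a quotient of the image of [g], which is a submodule of [N]. *)
Lemma serre_subquotient M N Q (g : {linear M -> N}) (q : {linear M -> Q}) :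
  surj q -> (forall x, g x = 0 -> q x = 0) -> S N -> S Q.
Proof.
move=> hq gq SN; have [I [p [i [ps iI pi]]]] := image_exists g.
have [|h hp] := factor_through_surj (h := q) ps.
  by move=> x px0; apply: gq; rewrite -pi px0 linear0.
apply: (serre_quo hS (g := h)); last exact: serre_sub iI SN.
by move=> y; have [x <-] := hq y; exists (p x).
Qed.

Lemma in_mod_fg_quo M N (g : {linear M -> N}) :
  surj g -> in_mod_fg S M -> in_mod_fg S N.
Proof.
move=> gs [s hs]; exists (map g s) => Q q qs qK.
apply: (hs _ (q \o g)) => [|x xs]; first exact: surj_comp.
by apply: qK; apply: map_f.
Qed.

(** The preimage [K] in [L] of the span of [s] is spanned by some list [t], up to
    elements killed by [f], of which there are none but [0].  Then [L / K] embeds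
    in [M] modulo the span of [s], and a quotient of [L] killing [t] is a
    quotient of [L / K]. *)
Lemma in_mod_fg_sub L M (f : {linear L -> M}) :
  noetherian R -> injective f -> in_mod_fg S M -> in_mod_fg S L.
Proof.
move=> hR fI [s hs].
have hK := submodule_preimage f (span_submodule s).
have [t _ ht] := noetherian_span (f := f) (s := s) hR hK (fun _ => id).
have [N [g [gs gK]]] := quotient_exists (span_submodule s).
have SN : S N by apply: (hs _ g) => // x xs; apply/gK; exact: mem_span.
exists t => Q q qs qt; apply: (serre_subquotient (g := g \o f) qs) SN => x.
move=> /gK/ht[y ty /fI ->]; exact: kill_span qt _ ty.
Qed.

(** A quotient [Q] of [M] has the image of [L] as a submodule, and the cokernel
    of [L -> Q] is a quotient of [N]; if [Q] kills lifts of the list of [N], then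
    this cokernel kills the list itself. *)
Lemma in_mod_fg_ext L M N (f : {linear L -> M}) (g : {linear M -> N}) :
  short_exact f g -> in_mod_fg S L -> in_mod_fg S N -> in_mod_fg S M.
Proof.
move=> [fI gs fg] [s hs] [t ht]; have [r rK] := choice gs.
exists (map f s ++ map r t) => Q q qs qK.
have [I [p [i [ps iI pi]]]] := image_exists (q \o f).
have SI : S I.
  apply: (hs _ p ps) => x xs; apply: iI; rewrite linear0 pi /=.
  by apply: qK; rewrite mem_cat map_f.
have [C [c [cs cK]]] := quotient_exists (submodule_image i).
have [|h hg] := factor_through_surj (h := c \o q) gs.
  by move=> x /fg[l <-] /=; apply/cK; exists (p l).
have SC : S C.
  apply: (ht _ h) => [y|x xt].
    by have [x <-] := surj_comp qs cs y; exists (g x).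
  by rewrite -[x]rK hg /= qK ?linear0 // mem_cat map_f ?orbT.
exact: (serre_ext hS (f := i) (g := c)).
Qed.

(** From left to right, generators of the submodule form the list: a quotient of
    [M] killing them is a quotient of [N].  From right to left, the span of the
    list and the quotient by it form the short exact sequence. *)
Lemma ext_subcatE M :
  ext_subcat (@finitely_generated R) S M <-> in_mod_fg S M.
Proof.
split=> [[L [N [f [g [[n [e eL]] SN [fI gs fg]]]]]]|[s hs]].
  exists (codom (f \o e)) => Q q qs qK.
  have [|h hg] := factor_through_surj (h := q) gs.
    move=> _ /fg[l <-]; have [a ->] := eL l.
    rewrite !linear_sum big1 // => i _; rewrite !linearZ /= qK ?scaler0 //.
    exact: (codom_f (f \o e)).
  apply: (serre_quo hS (g := h)) SN => y.
  by have [x <-] := qs y; exists (g x).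
have [Q [q [qs qK]]] := quotient_exists (span_submodule s).
(* The span of [s] is the image of [u], from a free module. *)
pose F : lmodType R := 'rV[R]_(size s).
pose v (a : F) : M := \sum_(i < size s) a 0 i *: s`_i.
have vlin : linear v.
  move=> a x y; rewrite /v scaler_sumr -big_split; apply: eq_bigr => i _.
  by rewrite !mxE scalerDl scalerA.
pose u : {linear F -> M} := HB.pack v (GRing.isLinear.Build R F M _ v vlin).
have [L [p [f [ps fI pf]]]] := image_exists u.
exists L, Q, f, q; split.
- exists (size s), (fun i => p (delta_mx 0 i)) => l; have [a <-] := ps l.
  exists (a 0); rewrite {1}[a]row_sum_delta linear_sum.
  by apply: eq_bigr => i _; rewrite linearZ.
- by apply: (hs _ q) => // x xs; apply/qK; exact: mem_span.
- split=> // m; split=> [/qK hm|[l <-]].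
    apply: (hm _ (submodule_image f)) => y ys.
    have ys' : (index y s < size s)%N by rewrite index_mem.
    exists (p (delta_mx 0 (Ordinal ys'))); rewrite pf /= /v.
    rewrite (bigD1 (Ordinal ys')) //= mxE !eqxx scale1r nth_index //.
    by rewrite big1 ?addr0 // => j /negbTE jy; rewrite mxE jy andbF scale0r.
  apply/qK; have [a <-] := ps l; rewrite pf /= /v.
  apply: (submod_sum (span_submodule _)) => i.
  by apply: (submodZ (span_submodule _)); apply: mem_span; apply: mem_nth.
Qed.

End QuotientsAndImages.

Theorem corollary3p3 (R : comPzRingType) (S : lmodType R -> Prop)
    (hR : noetherian R) (hS : serre S) :
  serre (ext_subcat (@finitely_generated R) S).
Proof.
split=> [M N f [f' fK f'K]|M M0|L M f fI|M N g gs|L M N f g fg].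
- move=> /(ext_subcatE hS) hM; apply/(ext_subcatE hS).
  by apply: in_mod_fg_quo hM => y; exists (f' y).
- apply/(ext_subcatE hS); exists [::] => Q q qs _; apply: (serre_zero hS) => y.
  by have [x <-] := qs y; rewrite (M0 x) linear0.
- move=> /(ext_subcatE hS) hM; apply/(ext_subcatE hS).
  exact: in_mod_fg_sub fI hM.
- move=> /(ext_subcatE hS) hM; apply/(ext_subcatE hS).
  exact: in_mod_fg_quo gs hM.
- move=> /(ext_subcatE hS) hL /(ext_subcatE hS) hN; apply/(ext_subcatE hS).
  exact: in_mod_fg_ext fg hL hN.
Qed.
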